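(* Let $n\in\mathbb N$ and let $b$ be the largest even integer in $[2,n-1]$. Then the number of matrices in $\mathcal{PSC}_n^{1,0}$ with exponent $b$ equals $2(2n-7)$ if $n\ge 5$ is odd, and equals $18$ if $n\ge 8$ is even.
   Context: For $n\ge 3$, let $C_n$ be the set of $n\times n$ real matrices $A$ whose row $i$ ($1\le i\le n-1$) has a single entry $1$ in column $i+1$ and zeros elsewhere, and whose last row has all entries in $\{0,1\}$. For $A\in C_n$ put $F(A)=A+A^T$. Let $C_n^{1,0}=\{F(A): A\in C_n,\ a_{n,1}=1,\ a_{n,n}=0\}$ and $\mathcal{PSC}_n^{1,0}$ the set of primitive matrices in it; a nonnegative matrix is primitive if some power is entrywise positive, and its exponent is the least such power. $[a,b]$ denotes the set of integers $k$ with $a\le k\le b$. *)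

(* Defs.v *)
From mathcomp Require Import all_boot all_order all_algebra.
From mathcomp Require Import classical_sets functions cardinality reals.

Set Implicit Arguments.
Unset Strict Implicit.
Unset Printing Implicit Defensive.

Import Order.TTheory GRing.Theory Num.Theory.

Local Open Scope classical_set_scope.
Local Open Scope ring_scope.

Definition entrywise_nonneg (R : realType) (n : nat) (M : 'M[R]_n) : Prop :=
  forall i j : 'I_n, 0 <= M i j.

Definition entrywise_positive (R : realType) (n : nat) (M : 'M[R]_n) : Prop :=
  forall i j : 'I_n, 0 < M i j.

Definition primitive (R : realType) (n : nat) (M : 'M[R]_n) : Prop :=
  entrywise_nonneg M /\
  exists k : nat, (0 < k)%N /\ entrywise_positive (M ^+ k).

Definition has_exponent (R : realType) (n : nat) (M : 'M[R]_n) (k : nat)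
    : Prop :=
  [/\ (0 < k)%N,
      entrywise_positive (M ^+ k) &
      forall l : nat, (0 < l)%N -> entrywise_positive (M ^+ l) -> (k <= l)%N].

(* Indices in 'I_n start at 0: the last row is the [i] with [i.+1 = n], the
   entry a_{n,1} is in column 0 and a_{n,n} in the column [j] with
   [j.+1 = n]. *)
Definition companion01 (R : realType) (n : nat) : set 'M[R]_n :=
  [set A | (forall i j : 'I_n, (i.+1 < n)%N ->
              A i j = (if j == i.+1 :> nat then 1 else 0)) /\
           (forall i j : 'I_n, i.+1 = n -> A i j = 0 \/ A i j = 1)].

Definition symmetrize (R : realType) (n : nat) (A : 'M[R]_n) : 'M[R]_n :=
  A + A^T.

Definition SC10 (R : realType) (n : nat) : set 'M[R]_n :=
  [set symmetrize A | A in
     [set A | companion01 A /\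
              (forall i j : 'I_n, i.+1 = n -> j = 0 :> nat -> A i j = 1) /\
              (forall i j : 'I_n, i.+1 = n -> j.+1 = n -> A i j = 0)]].

Definition PSC10 (R : realType) (n : nat) : set 'M[R]_n :=
  [set M | SC10 M /\ primitive M].

Arguments companion01 : clear implicits.
Arguments SC10 : clear implicits.
Arguments PSC10 : clear implicits.

(* Main.v *)
(* Number the vertices 0, ..., H with H = n - 1.  The graph of F(A) is the path
   0, 1, ..., H together with edges joining the hub H to 0 and to a set S of
   vertices s with 1 <= s <= H - 2 (the chords); the entry a_{n,n-1} only
   doubles an edge of the path, whence the factor 2 in the counts.  As b is
   even, the exponent is b iff walks of length b join any two vertices, while
   some two vertices are not joined by a walk of length b - 1.

   n odd.  The Hamiltonian cycle is odd, which gives the walks of length n - 1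
   and, for u <> v, of length n - 2.  A closed walk of length n - 2 can only be
   missing if S is empty, {s} or {s, s + 2}: two chords at a distance other than
   2 produce, at each vertex, an odd closed walk of length at most n - 2.

   n even.  If all chords are at even vertices the graph is bipartite.  If not,
   walks of length n - 3 exist as soon as S contains an odd s with
   3 <= s <= H - 4, or {1, o, H - 2} with o even, or {1, o} with o >= 6 even, or
   the mirror image of the latter; nine sets S remain.

   For the remaining sets the missing walks are excluded by a certificate
   F : V -> Z with |F x + F y| <= 2 on every edge, built from the positions
   along a long odd cycle. *)

Require Import Defs.
From mathcomp Require Import all_boot all_order all_algebra.
From mathcomp Require Import classical_sets functions cardinality reals.
From mathcomp Require Import zify.

Set Implicit Arguments.
Unset Strict Implicit.
Unset Printing Implicit Defensive.

(** * The graph, its walks and the path *)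

Definition adj (H : nat) (S : pred nat) (x y : nat) : bool :=
  [&& x <= H, y <= H, x != y &
   [|| y == x.+1, x == y.+1, (x == H) && ((y == 0) || S y)
     | (y == H) && ((x == 0) || S x)]].

Fixpoint walk (H : nat) (S : pred nat) (k u v : nat) : Prop :=
  if k is k'.+1 then exists2 w, adj H S u w & walk H S k' w v else u = v.

Lemma walk_cat H S k l u w v :
  walk H S k u w -> walk H S l w v -> walk H S (k + l) u v.
Proof.
elim: k u => [|k IHk] u /=; first by move=> ->.
by case=> x ux xw wv; exists x => //; apply: IHk.
Qed.

Lemma walk_adj H S u v : adj H S u v -> walk H S 1 u v.
Proof. by move=> uv; exists v. Qed.

Lemma adj_sym H S u v : adj H S u v -> adj H S v u.
Proof. rewrite /adj; lia. Qed.

Lemma adj_exists H S u : 0 < H -> u <= H -> exists w, adj H S u w.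
Proof.
by exists (if u == H then u.-1 else u.+1); rewrite /adj; case: eqP; lia.
Qed.

(** The two extra steps go back and forth along an edge at [u]; this is why below only a short walk
    of the right parity is ever exhibited. *)
Lemma walk_add2 H S k u v :
  0 < H -> u <= H -> walk H S k u v -> walk H S k.+2 u v.
Proof.
move=> H0 uH uv; have [w uw] := adj_exists S H0 uH.
by exists w => //; exists u => //; apply: adj_sym.
Qed.

Lemma walk_leq H S k l u v :
  0 < H -> u <= H -> k <= l -> odd k = odd l -> walk H S k u v ->
  walk H S l u v.
Proof.
move=> H0 uH kl kl2 uv.
have -> : l = ((l - k)./2).*2 + k by lia.
by elim: (_./2) => // m IH; rewrite doubleS; apply: walk_add2.
Qed.

Lemma walk_path H S k u v :
  0 < H -> u <= H -> v <= H -> (u - v) + (v - u) <= k ->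
  ~~ odd (k + u + v) -> walk H S k u v.
Proof.
move=> H0 uH vH uvk par.
apply: (@walk_leq _ _ ((u - v) + (v - u))) => //; first by lia.
have {uvk par} [d] := ubnP ((u - v) + (v - u)).
elim: d u uH => // d IH u uH dlt.
case: (eqVneq u v) => [-> | uv]; first by rewrite subnn.
pose w := if u < v then u.+1 else u.-1.
have [wH uw duw] : [/\ w <= H, adj H S u w &
    (u - v) + (v - u) = ((w - v) + (v - w)).+1].
  by rewrite /w /adj; case: ltnP; split; lia.
by rewrite duw; exists w => //; apply: IH; lia.
Qed.

(** * Routes through the hub *)

(* Kept in [Prop] rather than [bool] so that [lia] does not case split on it. *)
Definition spoke (H : nat) (S : pred nat) (t : nat) : Prop :=
  t < H /\ adj H S t H = true.

Lemma spoke_adj H S t : spoke H S t -> adj H S t H.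
Proof. by case. Qed.

Lemma spoke0 H S : 0 < H -> spoke H S 0.
Proof. by split=> //; rewrite /adj; lia. Qed.

Lemma spoke_pred H S : 0 < H -> spoke H S H.-1.
Proof. by split; [lia | rewrite /adj; lia]. Qed.

Lemma spoke_chord H (S : pred nat) t : t < H -> S t -> spoke H S t.
Proof. by move=> tH St; split=> //; rewrite /adj St; lia. Qed.

Lemma walk_to_hub H S t u :
  u <= H -> spoke H S t -> walk H S ((u - t) + (t - u)).+1 u H.
Proof.
move=> uH tH; rewrite -addn1; apply: walk_cat (walk_adj (spoke_adj tH)).
by apply: walk_path; case: tH; lia.
Qed.

Lemma walk_from_hub H S t v :
  v <= H -> spoke H S t -> walk H S ((v - t) + (t - v)).+1 H v.
Proof.
move=> vH tH; rewrite -add1n.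
apply: walk_cat (walk_adj (adj_sym (spoke_adj tH))) _.
by apply: walk_path; case: tH; lia.
Qed.

(** Route: along the path from [u] to [t], over the spoke to the hub, then down the path from [H] to
    [v]. *)
Lemma walk_spoke H S t k u v :
  spoke H S t -> u <= H -> v <= H -> (u - t) + (t - u) + (H - v) < k ->
  odd (k + u + t + v + H) -> walk H S k u v.
Proof.
move=> tH uH vH lek par.
apply: (@walk_leq _ _ ((u - t + (t - u)).+1 + (H - v))); try lia.
  by case: tH; lia.
apply: walk_cat (walk_to_hub uH tH) _.
by apply: walk_path; case: tH; lia.
Qed.

Lemma walk_spoke2 H S t t' k u v :
  spoke H S t -> spoke H S t' -> u <= H -> v <= H ->
  (u - t) + (t - u) + (v - t') + (t' - v) + 2 <= k ->
  ~~ odd (k + u + t + v + t') -> walk H S k u v.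
Proof.
move=> tH tH' uH vH lek par.
apply: (@walk_leq _ _ ((u - t + (t - u)).+1 + (v - t' + (t' - v)).+1)); try lia.
  by case: tH; lia.
exact: walk_cat (walk_to_hub uH tH) (walk_from_hub vH tH').
Qed.

Lemma walk_hub_loop H S t1 t2 k :
  spoke H S t1 -> spoke H S t2 -> (t1 - t2) + (t2 - t1) + 2 <= k ->
  ~~ odd (k + t1 + t2) -> walk H S k H H.
Proof.
move=> t1H t2H lek par.
have [t1leH H0] : t1 <= H /\ 0 < H by case: t1H; lia.
apply: (@walk_leq _ _ (1 + ((t1 - t2) + (t2 - t1)).+1)); try lia.
exact: walk_cat (walk_adj (adj_sym (spoke_adj t1H))) (walk_to_hub t1leH t2H).
Qed.

(** The route of [walk_spoke2] with a closed detour hub, [t1], ..., [t2], hub in the middle, used to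
    change the parity. *)
Lemma walk_spoke4 H S t t1 t2 t' k u v :
  spoke H S t -> spoke H S t1 -> spoke H S t2 -> spoke H S t' ->
  u <= H -> v <= H ->
  (u - t) + (t - u) + (t1 - t2) + (t2 - t1) + (v - t') + (t' - v) + 4 <= k ->
  ~~ odd (k + u + t + t1 + t2 + v + t') -> walk H S k u v.
Proof.
move=> tH t1H t2H tH' uH vH lek par.
have [t1leH H0] : t1 <= H /\ 0 < H by case: t1H; lia.
apply: (@walk_leq _ _ ((u - t + (t - u)).+1 +
  (((t1 - t2) + (t2 - t1) + 2) + (v - t' + (t' - v)).+1))); try lia.
apply: walk_cat (walk_to_hub uH tH) _.
apply: walk_cat (walk_from_hub vH tH').
by apply: (walk_hub_loop t1H t2H); lia.
Qed.

(** * Walks for even [H] *)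

(* Of the two arcs of the odd Hamiltonian cycle, one is odd and, for distinct
   ends, not the whole cycle. *)
Lemma walk_odd_neq H S u v :
  ~~ odd H -> u <= H -> v <= H -> u != v -> walk H S H.-1 u v.
Proof.
move=> Hev uH vH uv.
have [?|?] := boolP (odd (u + v)); first by apply: walk_path; lia.
have a0 : spoke H S 0 by apply: spoke0; lia.
have aH : spoke H S H.-1 by apply: spoke_pred; lia.
case: (eqVneq v H) => [?|?]; first by apply: (walk_spoke a0); lia.
case: (eqVneq u H) => [?|?]; first subst u.
  by apply: (walk_leq _ _ _ _ (walk_from_hub vH a0)); lia.
by case: (ltnP u v) => ?;
  [apply: (walk_spoke2 a0 aH)|apply: (walk_spoke2 aH a0)]; lia.
Qed.

(** Two of the spokes [0], [s], [t], [H.-1] at an odd distance close an odd cycle through the hub.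
    If no short enough one passes through [u], the walk goes to the hub, round such a cycle, and
    back. *)
Lemma walk_odd_diag H (S : pred nat) s t u :
  ~~ odd H -> 0 < s < t -> t < H.-1 -> t != s.+2 -> spoke H S s -> spoke H S t ->
  u <= H ->
  walk H S H.-1 u u.
Proof.
move=> Hev st tH ts as_ at_ uH.
have a0 : spoke H S 0 by apply: spoke0; lia.
have aH : spoke H S H.-1 by apply: spoke_pred; lia.
have [->|uH'] := eqVneq u H.
  have [so|so] := boolP (odd s); first by apply: (walk_hub_loop a0 as_); lia.
  have [to|to] := boolP (odd t); first by apply: (walk_hub_loop as_ at_); lia.
  by apply: (walk_hub_loop at_ aH); lia.
have [us|su] := leqP u s.
  have [so|so] := boolP (odd s); first by apply: (walk_spoke2 a0 as_); lia.
  have [to|to] := boolP (odd t); first by apply: (walk_spoke2 a0 at_); lia.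
  (* Here [s] and [t] are even, so [t != s.+2] gives [t >= s + 4]. The nearer of the spokes [0] and
     [s] costs at most [s] both ways, and the cycle over [t] and [H.-1] still fits. *)
  have [?|?] := leqP (u + u) s.
    by apply: (walk_spoke4 a0 at_ aH a0); lia.
  by apply: (walk_spoke4 as_ at_ aH as_); lia.
have [ut|tu] := leqP u t.
  have [|/= sto] := boolP (odd (s + t)).
    by move=> ?; apply: (walk_spoke2 as_ at_); lia.
  have [so|so] := boolP (odd s); first by apply: (walk_spoke2 a0 at_); lia.
  by apply: (walk_spoke2 as_ aH); lia.
have [to|to] := boolP (odd t); last by apply: (walk_spoke2 at_ aH); lia.
have [so|so] := boolP (odd s); last by apply: (walk_spoke2 as_ aH); lia.
(* Mirror image of the case above: [s] and [t] are odd, and the odd cycle is the one over [0] and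
   [s]. *)
have [?|?] := leqP (u - t) (H.-1 - u).
  by apply: (walk_spoke4 at_ a0 as_ at_); lia.
by apply: (walk_spoke4 aH a0 as_ aH); lia.
Qed.

(** For distinct ends, the even one of the two arcs of the odd Hamiltonian cycle has at most [H]
    edges. *)
Lemma walk_even_H H S u v :
  0 < H -> ~~ odd H -> u <= H -> v <= H -> walk H S H u v.
Proof.
move=> H0 Hev uH vH.
have [?|?] := boolP (odd (u + v)); last by apply: walk_path; lia.
have a0 : spoke H S 0 by apply: spoke0; lia.
have aH : spoke H S H.-1 by apply: spoke_pred; lia.
case: (eqVneq v H) => [?|?]; first by apply: (walk_spoke a0); lia.
case: (eqVneq u H) => [?|?]; first subst u.
  by apply: (walk_leq _ _ _ _ (walk_from_hub vH a0)); lia.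
by case: (ltnP u v) => ?;
  [apply: (walk_spoke2 a0 aH)|apply: (walk_spoke2 aH a0)]; lia.
Qed.

(** * Reversal and reflection *)

Lemma walk_sym H S k u v : walk H S k u v -> walk H S k v u.
Proof.
elim: k u => [|k IHk] u /=; first by move=> ->.
case=> w uw wv; have := walk_cat (IHk _ wv) (walk_adj (adj_sym uw)).
by rewrite addn1.
Qed.

Lemma walk_map H S S' f k u v :
  (forall x y, adj H S x y -> adj H S' (f x) (f y)) ->
  walk H S k u v -> walk H S' k (f u) (f v).
Proof.
move=> fE; elim: k u => [|k IHk] u /=; first by move=> ->.
by case=> w uw wv; exists (f w); [apply: fE | apply: IHk].
Qed.

(** The reflection of the Hamiltonian cycle that fixes the hub; it exchanges a chord set and its
    mirror image. *)
Definition flip (H x : nat) : nat := if x == H then H else H.-1 - x.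

Definition mirror (H : nat) (S : pred nat) : pred nat := fun x => S (H.-1 - x).

Lemma flipK H x : x <= H -> flip H (flip H x) = x.
Proof.
rewrite /flip; case: (eqVneq x H) => [->|xH] xleH; first by rewrite eqxx.
by case: eqVneq; lia.
Qed.

Lemma flip_leq H x : x <= H -> flip H x <= H.
Proof. rewrite /flip; case: eqP; lia. Qed.

Lemma adj_unflip H S x y :
  adj H (mirror H S) x y -> adj H S (flip H x) (flip H y).
Proof.
rewrite /adj /mirror /flip; case: (eqVneq x H) => [->|xH].
  case: (eqVneq y H) => [->|yH]; first by lia.
  case: (S (H.-1 - y)); lia.
case: (eqVneq y H) => [->|yH]; last by lia.
case: (S (H.-1 - x)); lia.
Qed.

Lemma walk_unflip H S k u v :
  u <= H -> v <= H -> walk H (mirror H S) k (flip H u) (flip H v) ->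
  walk H S k u v.
Proof.
move=> uH vH /(walk_map (@adj_unflip _ _)).
by rewrite !flipK.
Qed.

Lemma walk_flip H S k u v :
  walk H S k u v -> walk H (mirror H S) k (flip H u) (flip H v).
Proof.
apply: walk_map => x y; rewrite /adj /mirror /flip.
case: (eqVneq x H) => [->|xH].
  case: (eqVneq y H) => [->|yH]; first by lia.
  case: (leqP y H) => [yH'|]; last by lia.
  have -> : H.-1 - (H.-1 - y) = y by lia.
  case: (S y); lia.
case: (eqVneq y H) => [->|yH]; last by lia.
case: (leqP x H) => [yH'|]; last by lia.
have -> : H.-1 - (H.-1 - x) = x by lia.
by case: (S x); lia.
Qed.

(** * Walks for odd [H] *)

(** The path suffices unless the ends are [0] and [H], which are adjacent. *)
Lemma walk_odd_parity H S k u v :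
  odd H -> u <= v <= H -> odd k -> H.-2 <= k -> odd (u + v) -> walk H S k u v.
Proof.
move=> Hodd uv ko lek uvo; have [?|?] := leqP (v - u) k.
  by apply: walk_path; lia.
have a0 : adj H S 0 H by rewrite /adj; lia.
have [-> ->] : u = 0 /\ v = H by lia.
by apply: (walk_leq _ _ _ _ (walk_adj a0)); lia.
Qed.

(** The chord splits the Hamiltonian cycle into two odd cycles of lengths [s + 2] and [H + 1 - s];
    the bounds on [s] make both at most [H - 2]. *)
Lemma walk_mid_chord H (S : pred nat) s u v :
  odd H -> odd s -> 3 <= s <= H - 4 -> spoke H S s -> u <= v <= H ->
  walk H S H.-2 u v.
Proof.
move=> Hodd so sH a1 uv.
have [?|uve] := boolP (odd (u + v)); first by apply: walk_odd_parity; lia.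
have a0 : spoke H S 0 by apply: spoke0; lia.
have aH : spoke H S H.-1 by apply: spoke_pred; lia.
have [vH|vH] := eqVneq v H.
  have [uH|uH] := eqVneq u H.
    by subst u v; apply: (walk_hub_loop a0 a1); lia.
  by apply: (walk_spoke a1); lia.
have [vs|sv] := leqP v s; first by apply: (walk_spoke2 a0 a1); lia.
have [su|us] := leqP s u; first by apply: (walk_spoke2 a1 aH); lia.
(* The two routes have odd lengths with sum [H + 3], so one of them is at most [H - 2]. *)
have [?|?] := leqP (u + 2 + (v - s)) H.-2.
  by apply: (walk_spoke2 a0 a1); lia.
by apply: (walk_spoke2 a1 aH); lia.
Qed.

(** The odd cycles over [1], [o] and over [o], [H - 2] have lengths [o + 1] and [H - o]; the
    vertices [0] and [H.-1] outside them lie on triangles with the hub. *)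
Lemma walk_two_triangles H (S : pred nat) o u v :
  odd H -> ~~ odd o -> 2 <= o <= H - 3 ->
  spoke H S 1 -> spoke H S o -> spoke H S (H - 2) ->
  7 <= H -> u <= v <= H -> walk H S H.-2 u v.
Proof.
move=> Hodd oe oH a1 ao a2 H7 uv.
have [?|uve] := boolP (odd (u + v)); first by apply: walk_odd_parity; lia.
have a0 : spoke H S 0 by apply: spoke0; lia.
have aH : spoke H S H.-1 by apply: spoke_pred; lia.
have [vH|vH] := eqVneq v H.
  have [uH|uH] := eqVneq u H.
    by subst u v; apply: (walk_hub_loop a0 a1); lia.
  by apply: (walk_spoke a1); lia.
have [u0|u0] := eqVneq u 0.
  have [v0|v0] := eqVneq v 0; first by apply: (walk_spoke2 a0 a1); lia.
  have [vH1|vH1] := eqVneq v H.-1; first by apply: (walk_spoke2 a1 aH); lia.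
  have [vo|vo] := leqP v o; first by apply: (walk_spoke2 a1 ao); lia.
  by apply: (walk_spoke2 a0 a2); lia.
have [vH1|vH1] := eqVneq v H.-1.
  have [uH1|uH1] := eqVneq u H.-1; first by apply: (walk_spoke2 a2 aH); lia.
  have [uo|uo] := leqP u o; first by apply: (walk_spoke2 a1 aH); lia.
  by apply: (walk_spoke2 a2 aH); lia.
have [vo|ov] := leqP v o; first by apply: (walk_spoke2 a1 ao); lia.
have [ou|uo] := leqP o u; first by apply: (walk_spoke2 ao a2); lia.
(* The lengths of the two routes are odd with sum [H + 1]. *)
have [?|?] := leqP (u - 1 + 2 + (v - o)) H.-2.
  by apply: (walk_spoke2 a1 ao); lia.
by apply: (walk_spoke2 ao a2); lia.
Qed.

Lemma walk_one_triangle H (S : pred nat) o u v :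
  odd H -> ~~ odd o -> 6 <= o <= H - 3 ->
  spoke H S 1 -> spoke H S o -> u <= v <= H ->
  walk H S H.-2 u v.
Proof.
move=> Hodd oe oH a1 ao uv.
have [?|uve] := boolP (odd (u + v)); first by apply: walk_odd_parity; lia.
have a0 : spoke H S 0 by apply: spoke0; lia.
have aH : spoke H S H.-1 by apply: spoke_pred; lia.
have [vH|vH] := eqVneq v H.
  have [uH|uH] := eqVneq u H.
    by subst u v; apply: (walk_hub_loop a0 a1); lia.
  by apply: (walk_spoke a1); lia.
have [u0|u0] := eqVneq u 0.
  have [v4|v4] := leqP 4 v; first by apply: (walk_spoke a1); lia.
  by apply: (walk_spoke2 a0 a1); lia.
have [uv'|uv'] := eqVneq u v; last by apply: (walk_spoke2 a1 aH); lia.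
have [uo|uo] := leqP u o; first by apply: (walk_spoke2 a1 ao); lia.
(* A visit to the triangle [0, 1, H] through the nearer of the spokes [o] and [H.-1] has length at
   most [(H - 1 - o) + 5], which is where [6 <= o] enters. *)
have [?|?] := leqP (u - o) (H.-1 - u).
  by apply: (walk_spoke4 ao a0 a1 ao); lia.
by apply: (walk_spoke4 aH a0 a1 aH); lia.
Qed.

(** The chord [1] closes the odd cycle [1, ..., H], whose even arcs have at most [H - 1] edges;
    vertex [0] is handled through its neighbours [1] and [H]. *)
Lemma walk_even_triangle H (S : pred nat) u v :
  odd H -> 7 <= H -> spoke H S 1 -> u <= v <= H -> walk H S H.-1 u v.
Proof.
move=> Hodd H7 a1 uv.
have [uvo|?] := boolP (odd (u + v)); last by apply: walk_path; lia.
have a0 : spoke H S 0 by apply: spoke0; lia.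
have [u0|u0] := eqVneq u 0; last by apply: (walk_spoke a1); lia.
have [v1|v1] := leqP v 1; first by apply: (walk_spoke2 a0 a1); lia.
by apply: (walk_spoke a1); lia.
Qed.

(** * Obstructions: bipartiteness and certificates *)

Lemma walk_bipartite H (S : pred nat) k u v :
  odd H -> (forall x, S x -> ~~ odd x) -> walk H S k u v ->
  odd k = odd (u + v).
Proof.
move=> Hodd Sev; elim: k u => [|k IHk] u /=; first by move=> ->; lia.
case=> w uw /IHk kw; suff: odd (u + w) by lia.
by move: uw (Sev u) (Sev w); rewrite /adj; lia.
Qed.

(* Such an [F] is, up to an alternating sign, 2-Lipschitz along walks, so a
   closed walk of odd length at [u] has length at least [|F u|]. *)
Lemma walk_certificate H S (F : nat -> int) k u v :
  (forall x y, adj H S x y -> (`|F x + F y| <= 2%:Z)%R) ->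
  walk H S k u v ->
  (`|F u + (if odd k then F v else - F v)| <= (k.*2)%:Z)%R.
Proof.
move=> FE; elim: k u => [|k IHk] u /=; first by move=> ->; rewrite GRing.subrr.
by case=> w /FE uw /IHk; move: uw; case: (odd k) => /=; lia.
Qed.

Lemma no_walk_certificate H S (F : nat -> int) k u :
  (forall x y, adj H S x y -> (`|F x + F y| <= 2%:Z)%R) -> odd k ->
  (k%:Z < `|F u|)%R -> ~ walk H S k u u.
Proof. by move=> FE ko kF /(walk_certificate FE); rewrite ko; lia. Qed.

(* The certificate of a cycle of odd length [N], [p] being the position of a
   vertex counted from the base point of the walk: the distances from the base
   point by walks of even and odd length are [(N + F) / 2] and [(N - F) / 2]. *)
Definition cyc_cert (N p : nat) : int :=
  (if odd p then N%:Z - p.*2%:Z else p.*2%:Z - N%:Z)%R.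

(** Besides consecutive positions this admits edges whose ends are, on opposite arcs from the base
    point, at distances [p] and [N - q] differing by at most one. *)
Lemma cyc_cert_near N p q :
  (if odd (p + q) then (p - q) + (q - p) <= 1 else N.-1 <= p + q <= N.+1) ->
  (`|cyc_cert N p + cyc_cert N q| <= 2%:Z)%R.
Proof.
by rewrite /cyc_cert oddD; case: (odd p); case: (odd q) => /=; lia.
Qed.

(** Counted from [r] on the Hamiltonian cycle, with [N = H + 1], the hub has position [H - r] and
    the two possible chord ends have positions [r] and [r + 2]; the sums are [N - 1] and [N + 1]. *)
Lemma no_walk_odd H (S : pred nat) r :
  ~~ odd H -> 0 < H -> r.*2 <= H ->
  (forall x, S x -> x = r.*2 \/ x = r.*2.+2) -> ~ walk H S H.-1 r r.
Proof.
move=> Hev H0 rH Ssub.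
apply: (@no_walk_certificate _ _
  (fun j => cyc_cert H.+1 (if j < r then j + H.+1 - r else j - r)));
  last 2 first.
- by lia.
- by rewrite ltnn subnn /cyc_cert /=; lia.
move=> x y; wlog xy : x y / x < y => [thw exy|].
  have [xy|xy|xy] := ltngtP x y; first exact: thw.
    by rewrite GRing.addrC; apply: thw xy (adj_sym exy).
  by move: exy; rewrite /adj; lia.
move=> exy; apply: cyc_cert_near.
have [yx|[yH xS]] : y = x.+1 \/ y = H /\ (x = 0 \/ x = r.*2 \/ x = r.*2.+2).
  by move: (Ssub x) exy; rewrite /adj; case: (S x) => [/(_ isT)|_]; lia.
- by case: (ltnP x r) => ?; case: (ltnP y r) => ?; case: ifP; lia.
- by case: (ltnP x r) => ?; case: (ltnP y r) => ?; case: ifP; lia.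
Qed.

(* Cycle [1, ..., H]; vertex [0] is a twin of vertex [1]. *)
Lemma no_walk_one_end H (S : pred nat) :
  odd H -> 3 <= H ->
  (forall x, S x -> x = 1 \/ x = 2 \/ x = 4) ->
  ~ walk H S H.-2 (H + 3)./2 (H + 3)./2.
Proof.
move=> Hodd H0 Ssub; set r := (H + 3)./2.
have rE : r.*2 = H + 3 by rewrite /r; lia.
apply: (@no_walk_certificate _ _ (fun j => cyc_cert H
   (let i := maxn j 1 in if i < r then i + H - r else i - r))); last 2 first.
- by lia.
- by rewrite /cyc_cert; case: ifP => /=; case: ltnP; lia.
move=> x y; wlog xy : x y / x < y => [thw exy|].
  have [xy|xy|xy] := ltngtP x y; first exact: thw.
    by rewrite GRing.addrC; apply: thw xy (adj_sym exy).
  by move: exy; rewrite /adj; lia.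
move=> exy; apply: cyc_cert_near => /=.
have [yx|[yH xS]] : y = x.+1 \/ y = H /\ (x = 0 \/ x = 1 \/ x = 2 \/ x = 4).
  by move: (Ssub x) exy; rewrite /adj; case: (S x) => [/(_ isT)|_]; lia.
- by case: (ltnP (maxn x 1) r) => ?; case: (ltnP (maxn y 1) r) => ?;
    case: ifP; lia.
- by case: (ltnP (maxn x 1) r) => ?; case: (ltnP (maxn y 1) r) => ?;
    case: ifP; lia.
Qed.

(* Cycle [1, ..., H]; vertex [0] is a twin of vertex [H]. *)
Lemma no_walk_both_ends H (S : pred nat) :
  odd H -> 3 <= H ->
  (forall x, S x -> x = 1 \/ x = H - 2) -> ~ walk H S H.-2 H./2 H./2.
Proof.
move=> Hodd H0 Ssub; set r := H./2.
have rE : r.*2 = H - 1 by rewrite /r; lia.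
pose p := fun j : nat => let i := if j == 0 then H else j in
  if i < r then i + H - r else i - r.
have pP z : [\/ z = 0 /\ p z = H - r, 0 < z < r /\ p z = z + H - r
  | 0 < z /\ r <= z /\ p z = z - r].
  rewrite /p; case: (eqVneq z 0) => [->|z0] /=.
    by constructor 1; case: ltnP; lia.
  by case: ltnP; [constructor 2|constructor 3]; lia.
apply: (@no_walk_certificate _ _ (fun j => cyc_cert H (p j))); last 2 first.
- by lia.
- by move: (p r) (pP r) => q qP; rewrite /cyc_cert; case: ifP; case: qP; lia.
move=> x y; wlog xy : x y / x < y => [thw exy|].
  have [xy|xy|xy] := ltngtP x y; first exact: thw.
    by rewrite GRing.addrC; apply: thw xy (adj_sym exy).
  by move: exy; rewrite /adj; lia.
move=> exy; apply: cyc_cert_near.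
move: (p x) (p y) (pP x) (pP y) => {pP}p q pP qP.
have [yx|[yH xS]] : y = x.+1 \/ y = H /\ (x = 0 \/ x = 1 \/ x = H - 2).
  by move: (Ssub x) exy; rewrite /adj; case: (S x) => [/(_ isT)|_]; lia.
- by case: pP; case: qP; case: ifP; lia.
- by case: pP; case: qP; case: ifP; lia.
Qed.

(** * The extremal chord sets *)

(* The chord sets giving exponent [b], as increasing sequences; since [M] has
   order [n = H + 1], [odd H] is the case of even [n]. *)
Definition extremal (H : nat) : seq (seq nat) :=
  if odd H then
    [:: [:: 1]; [:: 1; 2]; [:: 1; 4]; [:: 1; 2; 4];
        [:: H - 2]; [:: H - 3; H - 2]; [:: H - 5; H - 2];
        [:: H - 5; H - 3; H - 2]; [:: 1; H - 2]]
  else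
    [::] :: [seq [:: s] | s <- iota 1 (H - 2)] ++
            [seq [:: s; s.+2] | s <- iota 1 (H - 4)].

Definition chords (H : nat) (s : seq nat) : Prop :=
  sorted ltn s /\ forall x, x \in s -> 0 < x < H.-1.

Lemma size_extremal_even H : ~~ odd H -> 4 <= H ->
  size (extremal H) = 2 * H - 5.
Proof.
move=> /negPf Hev H4; rewrite /extremal Hev /=.
by rewrite size_cat !size_map !size_iota; lia.
Qed.

Lemma extremalP_even H s : ~~ odd H -> s \in extremal H ->
  [\/ s = [::], exists2 x, s = [:: x] & 0 < x < H.-1
    | exists2 x, s = [:: x; x.+2] & 0 < x < H - 3].
Proof.
move=> /negPf Hev; rewrite /extremal Hev inE => /orP[/eqP->|].
  by constructor 1.
rewrite mem_cat => /orP[] /mapP[x]; rewrite mem_iota => xH ->.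
  by constructor 2; exists x => //; lia.
by constructor 3; exists x => //; lia.
Qed.

Lemma uniq_extremal H : 6 <= H \/ ~~ odd H -> uniq (extremal H).
Proof.
rewrite /extremal; case: ifP => [Hodd [H6|//] | _ _].
  rewrite /= !inE !negb_or -!andbA.
  by repeat (apply/andP; split => //); apply/eqP => -[]; lia.
have inj1 : injective (fun s : nat => [:: s]) by move=> x y [].
have inj2 : injective (fun s : nat => [:: s; s.+2]) by move=> x y [].
rewrite cons_uniq cat_uniq !map_inj_uniq // !iota_uniq mem_cat /= andbT.
apply/andP; split.
  by apply/norP; split; apply/mapP => -[].
by apply/hasPn => _ /mapP[x _ ->]; apply/mapP => -[].
Qed.

Lemma extremal_chords H s : 6 <= H \/ ~~ odd H -> s \in extremal H ->
  chords H s.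
Proof.
have [Hodd [H6|//]|Hev _] := boolP (odd H).
  rewrite /extremal Hodd => sH.
  have: all (fun s => sorted ltn s && all (fun x => 0 < x < H.-1) s)
    (extremal H) by rewrite /extremal Hodd /=; lia.
  rewrite /extremal Hodd => /allP/(_ s sH) /andP[? /allP ?]; by split.
by case/(extremalP_even Hev) => [->|[x -> xH]|[x -> xH]]; split => //=;
  try (by lia); move=> y; rewrite !inE; lia.
Qed.

(** Identifies a chord set inside a short explicit list by deciding the membership of each entry of
    that list. *)
Lemma sub_sorted_filter s t : sorted ltn s -> sorted ltn t ->
  {subset s <= t} -> s = [seq x <- t | x \in s].
Proof.
move=> ss st sub; apply: (irr_sorted_eq ltn_trans ltnn) => //.
  exact: sorted_filter ltn_trans _ _ st.
by move=> x; rewrite mem_filter; case: (boolP (x \in s)) => // /sub ->.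
Qed.

Definition chord_pred (s : seq nat) : pred nat := fun x => x \in s.

Lemma spoke_mirror H s t : t < H -> H.-1 - t \in s ->
  spoke H (mirror H (chord_pred s)) t.
Proof. by move=> tH ts; apply: spoke_chord. Qed.

Lemma walk_wlog H S k : (forall u v, u <= v <= H -> walk H S k u v) ->
  forall u v, u <= H -> v <= H -> walk H S k u v.
Proof.
move=> W u v uH vH; have [uv|vu] := leqP u v; first by apply: W; lia.
by apply: walk_sym; apply: W; lia.
Qed.

Lemma walk_mirror H S k :
  (forall u v, u <= v <= H -> walk H (mirror H S) k u v) ->
  forall u v, u <= H -> v <= H -> walk H S k u v.
Proof.
move=> W u v uH vH; apply: walk_unflip => //.
by apply: (walk_wlog W); apply: flip_leq.
Qed.

(** * Walk lengths for extremal and other chord sets *)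

Lemma extremal_walk_odd H s u v : odd H -> 7 <= H -> s \in extremal H ->
  u <= H -> v <= H -> walk H (chord_pred s) H.-1 u v.
Proof.
move=> Hodd H7 sH; have [s1|s2] : 1 \in s \/ H - 2 \in s.
  have: all (fun s => (1 \in s) || (H - 2 \in s)) (extremal H).
    by rewrite /extremal Hodd /= !inE !eqxx !orbT.
  by move/allP/(_ s sH)/orP.
  apply: walk_wlog => x y xy; apply: walk_even_triangle => //.
  by apply: spoke_chord => //; lia.
apply: walk_mirror => x y xy; apply: walk_even_triangle => //.
by apply: spoke_mirror; [lia | have -> : H.-1 - 1 = H - 2 by lia].
Qed.

Lemma extremal_no_walk_odd H s : odd H -> 7 <= H -> s \in extremal H ->
  exists2 u, u <= H & ~ walk H (chord_pred s) H.-2 u u.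
Proof.
move=> Hodd H7; rewrite /extremal Hodd.
rewrite (_ : [:: _, _, _, _, _ & _] =
  [:: [:: 1]; [:: 1; 2]; [:: 1; 4]; [:: 1; 2; 4]] ++
  [:: [:: H - 2]; [:: H - 3; H - 2]; [:: H - 5; H - 2];
    [:: H - 5; H - 3; H - 2]] ++ [:: [:: 1; H - 2]]) //.
rewrite !mem_cat => /or3P[sH|sH|].
(* From this base point on the cycle [1, ..., H], the position of the hub and those of the chord
   ends [2] and [4] have sums [H - 1] and [H + 1]. *)
- exists (H + 3)./2; first by lia.
  apply: no_walk_one_end => //; first by lia.
  by move=> x; rewrite /chord_pred; move: sH; rewrite !inE;
    case/or4P => /eqP ->; rewrite !inE; lia.
- exists (flip H (H + 3)./2); first by apply: flip_leq; lia.
  move/walk_flip; rewrite flipK; last by lia.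
  apply: no_walk_one_end => //; first by lia.
  by move=> x; rewrite /mirror /chord_pred; move: sH; rewrite !inE;
    case/or4P => /eqP ->; rewrite !inE; lia.
(* From this base point, the chord at [H - 2] has position sum [H - 1], and the edge from [H] to its
   twin [0] has position sum [H + 1]. *)
rewrite inE => /eqP->; exists H./2; first by lia.
apply: no_walk_both_ends => //; first by lia.
by move=> x; rewrite /chord_pred !inE; lia.
Qed.

Lemma nonextremal_odd H s : odd H -> 7 <= H -> chords H s ->
  s \notin extremal H ->
  (forall u v, u <= H -> v <= H -> walk H (chord_pred s) H.-2 u v) \/
  (forall x, chord_pred s x -> ~~ odd x).
Proof.
move=> Hodd H7 [srt rng] sH.
have spk t : t \in s -> spoke H (chord_pred s) t.
  by move=> ts; apply: spoke_chord => //; move: (rng t ts); lia.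
have spk' t : t \in s -> spoke H (mirror H (chord_pred s)) (H.-1 - t).
  move=> ts; apply: spoke_mirror; first by move: (rng t ts); lia.
  by have -> : H.-1 - (H.-1 - t) = t by move: (rng t ts); lia.
have [/hasP[x xs xmid]|/hasPn nomid] :=
    boolP (has (fun x => odd x && (3 <= x <= H - 4)) s).
  by left; apply: walk_wlog => u v;
    apply: (walk_mid_chord _ _ _ (spk x xs)); lia.
have odds x : x \in s -> odd x -> x = 1 \/ x = H - 2.
  by move=> xs; move: (nomid x xs) (rng x xs); lia.
have [s1|s1] := boolP (1 \in s); have [s2|s2] := boolP (H - 2 \in s).
- left; have [/hasP[o os oe]|/hasPn noe] := boolP (has (fun x => ~~ odd x) s).
    apply: walk_wlog => u v; have oH := rng o os.
    by apply: (walk_two_triangles _ _ _ (spk _ s1) (spk _ os) (spk _ s2)); lia.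
  case/negP: sH; rewrite /extremal Hodd
    (@sub_sorted_filter s [:: 1; H - 2]) //=.
  + by rewrite s1 s2 !inE eqxx !orbT.
  + by lia.
  + by move=> x xs; move: (noe x xs) (odds x xs); rewrite !inE; lia.
(* If no even chord is at least [6], then [s] is [1] together with some of [2] and [4]: four
   extremal sets. *)
- left; have [/hasP[o os oe]|/hasPn noe] :=
      boolP (has (fun x => ~~ odd x && (6 <= x)) s).
    apply: walk_wlog => u v; have oH := rng o os.
    by apply: (walk_one_triangle _ _ _ (spk _ s1) (spk _ os)); lia.
  case/negP: sH; rewrite /extremal Hodd (@sub_sorted_filter s [:: 1; 2; 4]) //=.
    by rewrite s1; case: (2 \in s); case: (4 \in s); rewrite !inE eqxx ?orbT.
  move=> x xs; have xH : x != H - 2 by apply: contraNneq s2 => <-.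
  by move: (noe x xs) (odds x xs) (rng x xs); rewrite !inE; lia.
(* The reflection takes [H - 2] to [1], and [o <= H - 7] to an even vertex that is at least [6]. *)
- left; have [/hasP[o os oe]|/hasPn noe] :=
      boolP (has (fun x => ~~ odd x && (x <= H - 7)) s).
    apply: walk_mirror => u v; have oH := rng o os.
    have spk1 := spk' _ s2.
    rewrite (_ : H.-1 - (H - 2) = 1) in spk1; last by lia.
    by apply: (walk_one_triangle _ _ _ spk1 (spk' _ os)); lia.
  case/negP: sH; rewrite /extremal Hodd
    (@sub_sorted_filter s [:: H - 5; H - 3; H - 2]) //=.
  + rewrite s2; case: (H - 3 \in s); case: (H - 5 \in s);
    by rewrite !inE eqxx ?orbT.
  + by lia.
  move=> x xs; have xH : x != 1 by apply: contraNneq s1 => <-.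
  by move: (noe x xs) (odds x xs) (rng x xs); rewrite !inE; lia.
right=> x; rewrite /chord_pred => xs; apply/negP => xo.
case: (odds x xs xo) => xE.
  by rewrite -xE xs in s1.
by rewrite -xE xs in s2.
Qed.

Lemma extremal_no_walk_even H s : ~~ odd H -> 4 <= H -> s \in extremal H ->
  exists2 u, u <= H & ~ walk H (chord_pred s) H.-1 u u.
Proof.
move=> Hev H4 sH.
(* As [H] is even, the reflection changes the parity of chord ends, so odd ones become even. *)
suff [r rH sub] : exists2 r, r.*2 <= H &
    (forall x, x \in s -> x = r.*2 \/ x = r.*2.+2) \/
    (forall x, H.-1 - x \in s -> x = r.*2 \/ x = r.*2.+2).
  case: sub => sub; first by exists r; [lia | apply: no_walk_odd => //; lia].
  exists (flip H r); first by apply: flip_leq; lia.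
  move/walk_flip; rewrite flipK; last by lia.
  by apply: no_walk_odd => //; lia.
case: (extremalP_even Hev sH) => [->|[x -> xH]|[x -> xH]].
- by exists 0 => //; left.
- have [xo|xe] := boolP (odd x).
    by exists (H.-1 - x)./2; [lia | right => y; rewrite !inE; lia].
  by exists x./2; [lia | left => y; rewrite !inE; lia].
have [xo|xe] := boolP (odd x).
  by exists (H - 3 - x)./2; [lia | right => y; rewrite !inE; lia].
by exists x./2; [lia | left => y; rewrite !inE; lia].
Qed.

Lemma nonextremal_even H s u v : ~~ odd H -> 4 <= H -> chords H s ->
  s \notin extremal H -> u <= H -> v <= H ->
  walk H (chord_pred s) H.-1 u v.
Proof.
move=> Hev H4 [srt rng] sH uH vH.
have [x [y [xs ys /andP[xy yx]]]] :
    exists x y, [/\ x \in s, y \in s & (x < y) && (y != x.+2)].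
  move: sH rng srt; rewrite /extremal (negPf Hev) inE mem_cat.
  case: s => [|x [|y s]] //= sH rng.
    case/negP: sH; apply/orP; left; apply/mapP; exists x => //.
    by rewrite mem_iota; move: (rng x (mem_head _ _)); lia.
  move=> /andP[xy pth].
  have xH := rng x (mem_head _ _).
  have yH : 0 < y < H.-1 by apply: rng; rewrite !inE eqxx orbT.
  have [yx|yx] := eqVneq y x.+2; last first.
    by exists x, y; rewrite !inE !eqxx !orbT xy yx.
  (* When the first two chords differ by [2], the first and the third differ by more. *)
  case: s pth sH {rng} => [|z s] /=; last first.
    move=> /andP[yz _] _; exists x, z.
    by split; rewrite ?inE ?eqxx ?orbT //; lia.
  move=> _ /negP[]; apply/orP; right; apply/mapP; exists x; last by rewrite yx.
  by rewrite mem_iota; lia.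
have [<-|uv] := eqVneq u v; last exact: walk_odd_neq.
have xH := rng x xs; have yH := rng y ys.
by apply: (@walk_odd_diag _ _ x y) => //;
  [lia | lia | apply: spoke_chord | apply: spoke_chord] => //; lia.
Qed.

(** * From walks to matrices *)

Import Order.TTheory GRing.Theory Num.Theory.

Local Open Scope classical_set_scope.
Local Open Scope card_scope.
Local Open Scope ring_scope.

(* [e] is the entry a_{n,n-1}: it does not change the graph, only whether the
   corresponding entry of the symmetrized matrix is 1 or 2. *)
Definition fan_row (H : nat) (s : seq nat) (e : bool) (j : nat) : bool :=
  [|| j == 0%N, j \in s | e && (j == H.-1)].

Definition fan_companion (R : realType) (H : nat) (s : seq nat) (e : bool)
    : 'M[R]_H.+1 :=
  \matrix_(i, j) (if (i < H)%N then (j == i.+1 :> nat)%:R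
                  else (fan_row H s e j)%:R).

Definition fan_mx (R : realType) (H : nat) (s : seq nat) (e : bool)
    : 'M[R]_H.+1 := symmetrize (fan_companion R H s e).

Lemma fan_mx_ge0 (R : realType) H s e : entrywise_nonneg (fan_mx R H s e).
Proof. by move=> i j; rewrite !mxE addr_ge0 //; case: ifP. Qed.

Lemma fan_mx_gt0 (R : realType) H s e (i j : 'I_H.+1) :
  chords H s -> (1 < H)%N ->
  (0 < fan_mx R H s e i j) = adj H (chord_pred s) i j.
Proof.
move=> [_ sH] H1; rewrite !mxE.
have pos (a b : bool) : (0 < a%:R + b%:R :> R) = a || b.
  by case: a; case: b; rewrite ?addr0 ?add0r ?ltr01 ?ltxx ?addr_gt0 ?ltr01.
rewrite -!(fun_if (fun b : bool => b%:R)) pos.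
rewrite /fan_row /adj /chord_pred.
move: (ltn_ord i) (ltn_ord j); move: (nat_of_ord i) (nat_of_ord j) => x y xH yH.
by case: (boolP (x \in s)) => [/sH xs|_]; case: (boolP (y \in s)) => [/sH ys|_];
  case: (ltnP x H) => ?; case: (ltnP y H) => ?; lia.
Qed.

(** A sum of nonnegative terms is positive iff some term is, and the index of that term is the
    second vertex of the walk. *)
Lemma expmx_walk (R : realType) H S (M : 'M[R]_H.+1) k (i j : 'I_H.+1) :
  entrywise_nonneg M -> (forall i j, (0 < M i j) = adj H S i j) ->
  0 <= (M ^+ k) i j /\ (0 < (M ^+ k) i j <-> walk H S k i j).
Proof.
move=> M0 MS; elim: k i => [|k IHk] i.
  rewrite expr0 mxE /=; case: eqVneq => [->|ij]; first by rewrite ler01 ltr01.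
  rewrite lexx ltxx; split=> //; split=> // ij'.
  by move: ij; rewrite -val_eqE /= ij' eqxx.
rewrite exprS mxE; have F0 l : true -> 0 <= M i l * (M ^+ k) l j.
  by rewrite mulr_ge0 //; case: (IHk l).
split; first exact: sumr_ge0.
split=> [Mij|[w iw wj]].
  have /psumr_neq0P[//|l /=] : \sum_l M i l * (M ^+ k) l j <> 0.
    by move=> E; rewrite E ltxx in Mij.
  have [Mk0 Mkw] := IHk l.
  rewrite lt0r mulf_eq0 negb_or => /andP[/andP[il lj] _].
  exists (nat_of_ord l); first by rewrite -MS lt0r il M0.
  by apply/Mkw; rewrite lt0r lj.
have wH : (w < H.+1)%N by move: iw; rewrite /adj; lia.
rewrite (bigD1 (Ordinal wH)) //= ltr_pwDl //.
  by rewrite mulr_gt0 ?MS //; apply/(IHk (Ordinal wH)).2.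
by apply: sumr_ge0 => l _; apply: F0.
Qed.

Lemma expmx_positive (R : realType) H S (M : 'M[R]_H.+1) k :
  entrywise_nonneg M -> (forall i j, (0 < M i j) = adj H S i j) ->
  entrywise_positive (M ^+ k) <->
  (forall u v, (u <= H)%N -> (v <= H)%N -> walk H S k u v).
Proof.
move=> M0 MS; split=> [Mk u v uH vH|W i j].
  by have /(_ (Ordinal (uH : u < H.+1)%N) (Ordinal (vH : v < H.+1)%N)) :=
    fun i j => (expmx_walk k i j M0 MS).2; case=> + _; apply.
by apply/(expmx_walk k i j M0 MS).2; apply: W; rewrite -ltnS ltn_ord.
Qed.

(** An arbitrary first edge can be prepended since all pairs are covered; hence minimality of an
    exponent [k.+1] need only be tested at [k]. *)
Lemma walk_all_leq H S k l : (0 < H)%N -> (k <= l)%N ->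
  (forall u v, (u <= H)%N -> (v <= H)%N -> walk H S k u v) ->
  (forall u v, (u <= H)%N -> (v <= H)%N -> walk H S l u v).
Proof.
move=> H0 kl W; rewrite -(subnK kl).
elim: (l - k)%N => [//|m IH] u v uH vH.
have [w uw] := adj_exists S H0 uH.
by exists w => //; apply: IH => //; move: uw; rewrite /adj; lia.
Qed.

Lemma has_exponent_walk (R : realType) H S (M : 'M[R]_H.+1) k :
  (0 < H)%N -> (0 < k)%N -> entrywise_nonneg M ->
  (forall i j, (0 < M i j) = adj H S i j) ->
  has_exponent M k.+1 <->
  (forall u v, (u <= H)%N -> (v <= H)%N -> walk H S k.+1 u v) /\
  ~ (forall u v, (u <= H)%N -> (v <= H)%N -> walk H S k u v).
Proof.
move=> H0 k0 M0 MS; split.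
  case=> _ /(expmx_positive _ M0 MS) W minM; split=> //.
  by move/(expmx_positive _ M0 MS)/(minM k k0); rewrite ltnn.
case=> W nW; split=> //; first exact/(expmx_positive _ M0 MS).
move=> l l0 /(expmx_positive _ M0 MS) Wl; rewrite ltnNge; apply/negP => lk.
exact/nW/(walk_all_leq H0 lk).
Qed.

Lemma SC10_fan (R : realType) H (M : 'M[R]_H.+1) : (3 <= H)%N ->
  SC10 R H.+1 M <-> exists s e, chords H s /\ M = fan_mx R H s e.
Proof.
move=> H3; split=> [[A [[Atop Alast] [A0 An]] <-]|[s [e [[_ sH] ->]]]].
  pose row j := A ord_max (inord j).
  (* Columns [1] to [H - 2] of the last row give the chords, column [H.-1] gives [e]. *)
  exists [seq j <- iota 1 (H - 2) | row j == 1], (row H.-1 == 1); split.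
    split; first exact: sorted_filter ltn_trans _ _ (iota_ltn_sorted _ _).
    by move=> x; rewrite mem_filter mem_iota => /andP[_]; lia.
  rewrite /fan_mx; congr symmetrize; apply/matrixP => i j; rewrite mxE.
  case: ltnP => iH; first by rewrite Atop //; case: eqP.
  have iE : i = ord_max by apply/val_inj => /=; move: (ltn_ord i); lia.
  subst i; rewrite /fan_row mem_filter mem_iota.
  have rowE : row j = A ord_max j by rewrite /row inord_val.
  have [j0|j0] := eqVneq (j : nat) 0%N; first by rewrite (A0 _ j).
  have [jH|jH] := eqVneq (j : nat) H.
    rewrite (An _ j) ?jH //; have -> : (1 <= H < 1 + (H - 2))%N = false by lia.
    have -> : (H == H.-1)%N = false by lia.
    by rewrite !andbF.
  have [jH1|jH1] := eqVneq (j : nat) H.-1.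
    rewrite -jH1 rowE; have -> : (1 <= j < 1 + (H - 2))%N = false by lia.
    rewrite andbF andbT /=.
    by case: (Alast ord_max j) => // ->; rewrite ?eqxx // eq_sym oner_eq0.
  have -> : (1 <= j < 1 + (H - 2))%N by move: (ltn_ord j); lia.
  rewrite rowE andbT andbF orbF /=.
  by case: (Alast ord_max j) => // ->; rewrite ?eqxx // eq_sym oner_eq0.
exists (fan_companion R H s e) => //; split; [split|split] => i j; rewrite !mxE.
- by rewrite ltnS => ->; case: eqP.
- by case=> ->; rewrite ltnn; case: (fan_row _ _ _ _); [right|left].
- by case=> -> ->; rewrite ltnn.
case=> -> [->]; rewrite ltnn /fan_row.
have -> : (H \in s) = false by apply/negP => /sH; lia.
have -> : (H == 0)%N = false by lia.
have -> : (H == H.-1)%N = false by lia.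
by rewrite andbF.
Qed.

(** In the last row, at columns before [H], the transpose adds a term independent of [s] and [e],
    which cancels. Column [H.-1] is never a chord, so it determines [e]. *)
Lemma fan_mx_inj (R : realType) H s e s' e' : (3 <= H)%N ->
  chords H s -> chords H s' -> fan_mx R H s e = fan_mx R H s' e' ->
  s = s' /\ e = e'.
Proof.
move=> H3 [srt sH] [srt' sH'] E.
have Ej j : (0 < j < H)%N -> fan_row H s e j = fan_row H s' e' j.
  move=> jH; have jH1 : (j < H.+1)%N by lia.
  move/matrixP/(_ ord_max (Ordinal jH1)): E; rewrite !mxE /= ltnn.
  have -> : (j < H)%N by lia.
  by move/addIr; case: (fan_row _ _ _ _); case: (fan_row _ _ _ _) => // /eqP;
    rewrite ?oner_eq0 // eq_sym oner_eq0.
split.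
  apply: (irr_sorted_eq ltn_trans ltnn) => // x.
  have [xH|xH] := boolP (0 < x < H.-1)%N.
    move: (Ej x); rewrite /fan_row; case: (x \in s); case: (x \in s'); lia.
  by apply/idP/idP => [/sH|/sH']; move: xH => /negP.
have nin t : (forall x, x \in t -> (0 < x < H.-1)%N) -> (H.-1 \in t) = false.
  by move=> tH; apply/negP => /tH; lia.
move: (Ej H.-1); rewrite /fan_row !nin // eqxx !andbT /=.
have -> : (H.-1 == 0)%N = false by lia.
by apply; lia.
Qed.

(** * Counting the matrices *)

Lemma card_image_seq (T : eqType) (U : Type) (f : T -> U) (xs : seq T) :
  uniq xs -> {in xs &, injective f} ->
  [set f x | x in [set x | x \in xs]] #= `I_(size xs).
Proof.
case: xs => [_ _|x0 xs].
  by rewrite /= II0 (_ : [set` [::]] = set0) ?image_set0 // eqEsubset; split.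
move: (x0 :: xs) => {}xs uxs finj.
have -> : [set f x | x in [set x | x \in xs]] =
    [set f (nth x0 xs i) | i in `I_(size xs)].
  rewrite eqEsubset; split=> _ [x /= xin <-].
    exists (index x xs); first by rewrite /= index_mem.
    by rewrite nth_index.
  by exists (nth x0 xs x) => //=; apply: mem_nth.
apply: inj_card_eq => i j; rewrite !inE /= => iH jH /finj E.
by apply/eqP; rewrite -(nth_uniq x0 iH jH uxs); apply/eqP/E; apply: mem_nth.
Qed.

(** The alternative for non-extremal sets reflects the two ways to miss the exponent [k.+1]: a
    smaller exponent, or walks still missing at length [k.+1]. The factor 2 counts the values of
    [e]. *)
Lemma card_extremal (R : realType) H k :
  (3 <= H)%N -> (6 <= H)%N \/ ~~ odd H -> (0 < k)%N ->
  (forall s, s \in extremal H ->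
    (forall u v, (u <= H)%N -> (v <= H)%N -> walk H (chord_pred s) k.+1 u v) /\
    ~ (forall u v, (u <= H)%N -> (v <= H)%N -> walk H (chord_pred s) k u v)) ->
  (forall s, chords H s -> s \notin extremal H ->
    (forall u v, (u <= H)%N -> (v <= H)%N -> walk H (chord_pred s) k u v) \/
    ~ (forall u v, (u <= H)%N -> (v <= H)%N ->
      walk H (chord_pred s) k.+1 u v)) ->
  [set M : 'M[R]_H.+1 | PSC10 R H.+1 M /\ has_exponent M k.+1]
    #= `I_(2 * size (extremal H)).
Proof.
move=> H3 Hc k0 ext nonext.
pose xs := [seq (s, e) | s <- extremal H, e <- [:: false; true]].
have xsP p : p \in xs -> p.1 \in extremal H.
  by case/allpairsP => -[s e] [/= sH _ ->].
have ch s : s \in extremal H -> chords H s := extremal_chords Hc.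
rewrite (_ : [set M | _] =
    [set fan_mx R H p.1 p.2 | p in [set p | p \in xs]]); last first.
  have expP s e : chords H s -> _ := fun sH => @has_exponent_walk R H
    (chord_pred s) (fan_mx R H s e) k (ltnW (ltnW H3)) k0
    (@fan_mx_ge0 R H s e) (fun i j => fan_mx_gt0 R e i j sH (ltnW H3)).
  rewrite eqEsubset; split=> [M [[+ _] +]|_ [[s e] /xsP /= sH <-]].
    case/(SC10_fan _ H3) => s [e [sH ->]] /(expP s e sH) [W nW].
    exists (s, e) => //=; apply: allpairs_f; last by case: e.
    by apply/negPn/negP => /(nonext s sH) [].
  have exps : has_exponent (fan_mx R H s e) k.+1.
    by apply/(expP s e (ch s sH)); apply: ext.
  split=> //; split.
    by apply/SC10_fan => //; exists s, e; split=> //; exact: ch.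
  split; first exact: fan_mx_ge0.
  by exists k.+1; case: exps.
have -> : (2 * size (extremal H))%N = size xs by rewrite size_allpairs mulnC.
apply: card_image_seq; first by apply: allpairs_uniq => //;
  [exact: uniq_extremal | move=> [? ?] [? ?]].
move=> [s e] [s' e'] /xsP /= /ch sH /xsP /= /ch sH' /(fan_mx_inj H3 sH sH').
by case=> -> ->.
Qed.

Unset Implicit Arguments.

Theorem theorem7 (R : realType) (n b : nat)
    (b_even : ~~ odd b) (b_range : (2 <= b <= n.-1)%N)
    (b_max : forall c : nat, ~~ odd c -> (2 <= c <= n.-1)%N -> (c <= b)%N) :
  ((5 <= n)%N -> odd n ->
     [set M : 'M[R]_n | PSC10 R n M /\ has_exponent M b]
       #= `I_(2 * (2 * n - 7))) /\
  ((8 <= n)%N -> ~~ odd n ->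
     [set M : 'M[R]_n | PSC10 R n M /\ has_exponent M b] #= `I_18).
Proof.
case: n b_range b_max => [|H]; first by lia.
rewrite [H.+1.-1]/= => b_range b_max; split=> Hn Ho.
  have bE : b = H.-1.+1 by move: (b_max H); lia.
  rewrite bE; have Hev : ~~ odd H by lia.
  have -> : (2 * H.+1 - 7 = size (extremal H))%N.
    by rewrite size_extremal_even //; lia.
  apply: card_extremal; [lia | by right | lia | | ].
    move=> s sH; split=> [u v|W].
      by rewrite prednK; [apply: walk_even_H => //; lia | lia].
    have [|u uH] := extremal_no_walk_even Hev _ sH; first by lia.
    by apply; apply: W.
  move=> s sH sn; left=> u v; apply: nonextremal_even => //; lia.
have bE : b = H.-2.+1 by move: (b_max H.-1); lia.
have Hodd : odd H by lia.
rewrite bE (_ : 18 = 2 * size (extremal H))%N; last by rewrite /extremal Hodd.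
apply: card_extremal; [lia | left; lia | lia | | ].
  move=> s sH; split=> [u v|W].
    rewrite (_ : H.-2.+1 = H.-1); last by lia.
    by apply: extremal_walk_odd => //; lia.
  have [|u uH] := extremal_no_walk_odd Hodd _ sH; first by lia.
  by apply; apply: W.
move=> s sH sn; have [|W|bip] := nonextremal_odd Hodd _ sH sn; first by lia.
  by left.
(* In a bipartite graph, walks from [0] to [0] and from [0] to [1] cannot have the same length. *)
right=> W; have := walk_bipartite Hodd bip (W 0 0 _ _).
have := walk_bipartite Hodd bip (W 0 1 _ _); lia.
Qed.
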